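(* Let $\mathfrak{L}$ be a left Leibniz algebra over a field $\mathbb{F}$. Then the weak universal enveloping algebra $\mathrm{UL}_{\mathrm{weak}}(\mathfrak{L})$ is a cocommutative Hopf algebra with comultiplication $\Delta:\mathrm{UL}_{\mathrm{weak}}(\mathfrak{L})\to\mathrm{UL}_{\mathrm{weak}}(\mathfrak{L})\otimes\mathrm{UL}_{\mathrm{weak}}(\mathfrak{L})$ defined by $$\Delta(\ell_x):=\ell_x\otimes 1+1\otimes\ell_x,\qquad \Delta(r_x):=r_x\otimes 1+1\otimes r_x,$$ counit $\varepsilon:\mathrm{UL}_{\mathrm{weak}}(\mathfrak{L})\to\mathbb{F}$ defined by $\varepsilon(\ell_x):=0=:\varepsilon(r_x)$, and antipode $S:\mathrm{UL}_{\mathrm{weak}}(\mathfrak{L})\to\mathrm{UL}_{\mathrm{weak}}(\mathfrak{L})$ defined by $S(\ell_x):=-\ell_x$ and $S(r_x):=-r_x$ (for all $x\in\mathfrak{L}$).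
   Context: A left Leibniz algebra is an $\mathbb{F}$-vector space $\mathfrak{L}$ with a bilinear multiplication satisfying $x(yz)=(xy)z+y(xz)$ for all $x,y,z\in\mathfrak{L}$. Let $\mathfrak{L}^\ell$ and $\mathfrak{L}^r$ be two isomorphic copies of the underlying vector space of $\mathfrak{L}$, via isomorphisms $\ell:\mathfrak{L}\to\mathfrak{L}^\ell$, $x\mapsto\ell_x$, and $r:\mathfrak{L}\to\mathfrak{L}^r$, $x\mapsto r_x$. Let $T(\mathfrak{L}^\ell\oplus\mathfrak{L}^r)$ be the tensor algebra and let $J(\mathfrak{L})$ be its two-sided ideal generated by $$\{\ell_x\cdot\ell_y-\ell_y\cdot\ell_x-\ell_{xy},\ \ell_x\cdot r_y-r_y\cdot\ell_x-r_{xy}\mid x,y\in\mathfrak{L}\}.$$ The weak universal enveloping algebra of $\mathfrak{L}$ is $\mathrm{UL}_{\mathrm{weak}}(\mathfrak{L}):=T(\mathfrak{L}^\ell\oplus\mathfrak{L}^r)/J(\mathfrak{L})$; the images of $\ell_x$ and $r_x$ in it are denoted by the same symbols. The maps $\Delta$ and $\varepsilon$ are the homomorphisms of unital algebras, and $S$ is the unital algebra anti-homomorphism, with the given values on the generators. *)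

(* Defs.v *)
From HB Require Import structures.
From mathcomp Require Import all_boot all_algebra.
From mathcomp Require Import boolp classical_sets.
From mathcomp Require Import finmap monalg.

Set Implicit Arguments.
Unset Strict Implicit.
Unset Printing Implicit Defensive.

Import GRing.Theory.
Local Open Scope ring_scope.
Local Open Scope quotient_scope.

(******************************************************************************)
(*            span G == linear span of the set G in a vector space            *)
(*           V /s G  == (lquot G) the quotient vector space V / span G        *)
(*       ideal_gen G == two-sided ideal generated by G in an algebra A        *)
(*           aquot G == the quotient algebra A / ideal_gen G                  *)
(*        tensor U V == U (x) V; u *t v is a pure tensor; tlift f is the      *)
(*                      linear map induced by a bilinear f                    *)
(*      tensor_alg V == the tensor algebra T(V), with tgen : V -> T(V)        *)
(*       UL_weak mul == the weak universal enveloping algebra, with           *)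
(*                      generators ell mul x and rr mul x                     *)
(******************************************************************************)

Section Span.
Variables (F : fieldType) (V : lmodType F).

Definition subspace (W : V -> Prop) : Prop :=
  W 0 /\ forall a x y, W x -> W y -> W (a *: x + y).

Definition span (G : V -> Prop) : pred V := fun x =>
  `[< forall W, subspace W -> (forall g, G g -> W g) -> W x >].

Lemma spanP (G : V -> Prop) x :
  reflect (forall W, subspace W -> (forall g, G g -> W g) -> W x) (x \in span G).
Proof. exact: asboolP. Qed.

Lemma span_submod_closed G : submod_closed (span G).
Proof.
split=> [|a x y /spanP xW /spanP yW]; apply/spanP=> W sW GW; case: (sW) => W0 WD //.
by apply: WD; [apply: xW | apply: yW].
Qed.

HB.instance Definition _ G := GRing.isZmodClosed.Build V (span G)
  (GRing.submod_closedB (span_submod_closed G)).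

Lemma mem_span (G : V -> Prop) g : G g -> g \in span G.
Proof. by move=> Gg; apply/spanP=> W _; apply. Qed.

Lemma span_ind (G W : V -> Prop) : subspace W -> (forall g, G g -> W g) ->
  forall x, x \in span G -> W x.
Proof. by move=> sW GW x /spanP; apply. Qed.

Lemma spanZ (G : V -> Prop) a x : x \in span G -> a *: x \in span G.
Proof. by move=> xG; rewrite -[_ *: _]addr0; apply: (span_submod_closed G).2 => //;
  exact: rpred0. Qed.

End Span.

Definition lquot (F : fieldType) (V : lmodType F) (G : V -> Prop) : Type :=
  Quotient.quot (GRing.ZmodClosed.clone V (span G) _).
HB.instance Definition _ (F : fieldType) (V : lmodType F) (G : V -> Prop) :=
  ZmodQuotient.on (lquot G).

HB.lock Definition lproj (F : fieldType) (V : lmodType F) (G : V -> Prop)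
  (x : V) : lquot G := \pi_(lquot G) x.

HB.lock Definition lrepr (F : fieldType) (V : lmodType F) (G : V -> Prop)
  (q : lquot G) : V := repr q.

HB.lock Definition lqscale (F : fieldType) (V : lmodType F) (G : V -> Prop)
  (a : F) (q : lquot G) : lquot G := lproj G (a *: lrepr q).

Section LinearQuotient.
Variables (F : fieldType) (V : lmodType F) (G : V -> Prop).
Local Notation lquot := (lquot G).
Local Notation lproj := (@lproj F V G).
Local Notation lrepr := (@lrepr F V G).
Local Notation lqscale := (@lqscale F V G).

Lemma lreprK q : lproj (lrepr q) = q.
Proof. by rewrite lproj.unlock lrepr.unlock reprK. Qed.

Lemma lproj_eq x y : (lproj x == lproj y) = (x - y \in span G).
Proof. by rewrite lproj.unlock Quotient.idealrBE. Qed.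

Lemma lrepr_proj x : lrepr (lproj x) - x \in span G.
Proof. by rewrite -lproj_eq lreprK. Qed.

Lemma lproj_is_zmod_morphism : zmod_morphism lproj.
Proof. by rewrite lproj.unlock; apply: (raddfB \pi_lquot). Qed.
HB.instance Definition _ :=
  GRing.isZmodMorphism.Build V lquot lproj lproj_is_zmod_morphism.

Lemma lqscaleE a x : lqscale a (lproj x) = lproj (a *: x).
Proof.
by apply/eqP; rewrite lqscale.unlock lproj_eq -scalerBr; apply/spanZ/lrepr_proj.
Qed.

Fact lqscaleA a b q : lqscale a (lqscale b q) = lqscale (a * b) q.
Proof. by rewrite -[q]lreprK !lqscaleE scalerA. Qed.
Fact lqscale1 : left_id 1 lqscale.
Proof. by move=> q; rewrite -[q]lreprK !lqscaleE scale1r. Qed.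
Fact lqscaleDr : right_distributive lqscale +%R.
Proof.
by move=> a p q; rewrite -[p]lreprK -[q]lreprK -raddfD !lqscaleE scalerDr raddfD.
Qed.
Fact lqscaleDl q : {morph lqscale^~ q : a b / a + b}.
Proof. by move=> a b; rewrite -[q]lreprK !lqscaleE scalerDl raddfD. Qed.

HB.instance Definition _ := GRing.Zmodule_isLmodule.Build F lquot
  lqscaleA lqscale1 lqscaleDr lqscaleDl.

Lemma lproj_is_scalable : scalable lproj.
Proof. by move=> a x; rewrite -[RHS]/(lqscale _ _) lqscaleE. Qed.
HB.instance Definition _ :=
  GRing.isScalable.Build F V lquot *:%R lproj lproj_is_scalable.

Lemma lproj_gen g : G g -> lproj g = 0.
Proof.
by move=> Gg; apply/eqP; rewrite -(raddf0 lproj) lproj_eq subr0 mem_span.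
Qed.

End LinearQuotient.

Section IdealGen.
Variables (F : fieldType) (A : algType F).

Definition two_sided_ideal (I : A -> Prop) : Prop :=
  [/\ I 0, forall x y, I x -> I y -> I (x + y),
      forall a x, I x -> I (a * x) & forall a x, I x -> I (x * a)].

Definition ideal_gen (G : A -> Prop) : pred A := fun x =>
  `[< forall I, two_sided_ideal I -> (forall g, G g -> I g) -> I x >].

Lemma ideal_genP (G : A -> Prop) x :
  reflect (forall I, two_sided_ideal I -> (forall g, G g -> I g) -> I x)
    (x \in ideal_gen G).
Proof. exact: asboolP. Qed.

Lemma mem_ideal_gen (G : A -> Prop) g : G g -> g \in ideal_gen G.
Proof. by move=> Gg; apply/ideal_genP=> I _; apply. Qed.

Lemma ideal_gen_ind (G I : A -> Prop) : two_sided_ideal I ->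
  (forall g, G g -> I g) -> forall x, x \in ideal_gen G -> I x.
Proof. by move=> sI GI x /ideal_genP; apply. Qed.

Lemma ideal_genMl (G : A -> Prop) a x :
  x \in ideal_gen G -> a * x \in ideal_gen G.
Proof.
by move=> /ideal_genP xI; apply/ideal_genP=> I sI GI; case: (sI) => _ _ + _; apply; apply: xI.
Qed.

Lemma ideal_genMr (G : A -> Prop) a x :
  x \in ideal_gen G -> x * a \in ideal_gen G.
Proof.
by move=> /ideal_genP xI; apply/ideal_genP=> I sI GI; case: (sI) => _ _ _; apply; apply: xI.
Qed.

Lemma ideal_genZ (G : A -> Prop) (a : F) x :
  x \in ideal_gen G -> a *: x \in ideal_gen G.
Proof. by move=> xI; rewrite -[x]mul1r scalerAl ideal_genMl. Qed.

Lemma ideal_gen_zmod_closed G : zmod_closed (ideal_gen G).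
Proof.
split=> [|x y xI yI]; first by apply/ideal_genP=> I [].
rewrite -mulN1r; have /ideal_genP yI' := ideal_genMl (-1) yI.
move/ideal_genP: xI => xI; apply/ideal_genP=> I sI GI.
by case: (sI) => _ ID _ _; apply: ID; [apply: xI | apply: yI'].
Qed.
HB.instance Definition _ G :=
  GRing.isZmodClosed.Build A (ideal_gen G) (ideal_gen_zmod_closed G).

End IdealGen.

Definition aquot (F : fieldType) (A : algType F) (G : A -> Prop) : Type :=
  Quotient.quot (GRing.ZmodClosed.clone A (ideal_gen G) _).
HB.instance Definition _ (F : fieldType) (A : algType F) (G : A -> Prop) :=
  ZmodQuotient.on (aquot G).

HB.lock Definition aproj (F : fieldType) (A : algType F) (G : A -> Prop)
  (x : A) : aquot G := \pi_(aquot G) x.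

HB.lock Definition arepr (F : fieldType) (A : algType F) (G : A -> Prop)
  (q : aquot G) : A := repr q.

HB.lock Definition aqscale (F : fieldType) (A : algType F) (G : A -> Prop)
  (a : F) (q : aquot G) : aquot G := aproj G (a *: arepr q).

HB.lock Definition aqmul (F : fieldType) (A : algType F) (G : A -> Prop)
  (p q : aquot G) : aquot G := aproj G (arepr p * arepr q).

Section AlgebraQuotient.
Variables (F : fieldType) (A : algType F) (G : A -> Prop).
Local Notation aquot := (aquot G).
Local Notation aproj := (@aproj F A G).
Local Notation arepr := (@arepr F A G).
Local Notation aqscale := (@aqscale F A G).
Local Notation aqmul := (@aqmul F A G).

Lemma areprK q : aproj (arepr q) = q.
Proof. by rewrite aproj.unlock arepr.unlock reprK. Qed.

Lemma aproj_eq x y : (aproj x == aproj y) = (x - y \in ideal_gen G).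
Proof. by rewrite aproj.unlock Quotient.idealrBE. Qed.

Lemma arepr_proj x : arepr (aproj x) - x \in ideal_gen G.
Proof. by rewrite -aproj_eq areprK. Qed.

Lemma aproj_is_zmod_morphism : zmod_morphism aproj.
Proof. by rewrite aproj.unlock; apply: (raddfB \pi_aquot). Qed.
HB.instance Definition _ :=
  GRing.isZmodMorphism.Build A aquot aproj aproj_is_zmod_morphism.

Lemma aqscaleE a x : aqscale a (aproj x) = aproj (a *: x).
Proof.
by apply/eqP; rewrite aqscale.unlock aproj_eq -scalerBr; apply/ideal_genZ/arepr_proj.
Qed.

Lemma aqmulE x y : aqmul (aproj x) (aproj y) = aproj (x * y).
Proof.
apply/eqP; rewrite aqmul.unlock aproj_eq -(subrK (x * arepr (aproj y)) (_ * _)) -mulrBl.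
rewrite -addrA -mulrBr rpredD //; first exact/ideal_genMr/arepr_proj.
exact/ideal_genMl/arepr_proj.
Qed.

Fact aqscaleA a b q : aqscale a (aqscale b q) = aqscale (a * b) q.
Proof. by rewrite -[q]areprK !aqscaleE scalerA. Qed.
Fact aqscale1 : left_id 1 aqscale.
Proof. by move=> q; rewrite -[q]areprK !aqscaleE scale1r. Qed.
Fact aqscaleDr : right_distributive aqscale +%R.
Proof.
by move=> a p q; rewrite -[p]areprK -[q]areprK -raddfD !aqscaleE scalerDr raddfD.
Qed.
Fact aqscaleDl q : {morph aqscale^~ q : a b / a + b}.
Proof. by move=> a b; rewrite -[q]areprK !aqscaleE scalerDl raddfD. Qed.

HB.instance Definition _ := GRing.Zmodule_isLmodule.Build F aquot
  aqscaleA aqscale1 aqscaleDr aqscaleDl.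

Fact aqmulA : associative aqmul.
Proof.
by move=> p q r; rewrite -[p]areprK -[q]areprK -[r]areprK !aqmulE mulrA.
Qed.
Fact aqmul1 : left_id (aproj 1) aqmul.
Proof. by move=> q; rewrite -[q]areprK aqmulE mul1r. Qed.
Fact aqmulr1 : right_id (aproj 1) aqmul.
Proof. by move=> q; rewrite -[q]areprK aqmulE mulr1. Qed.
Fact aqmulDl : left_distributive aqmul +%R.
Proof.
move=> p q r; rewrite -[p]areprK -[q]areprK -[r]areprK.
by rewrite -raddfD !aqmulE mulrDl raddfD.
Qed.
Fact aqmulDr : right_distributive aqmul +%R.
Proof.
move=> p q r; rewrite -[p]areprK -[q]areprK -[r]areprK.
by rewrite -raddfD !aqmulE mulrDr raddfD.
Qed.

HB.instance Definition _ := GRing.Zmodule_isPzRing.Build aquot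
  aqmulA aqmul1 aqmulr1 aqmulDl aqmulDr.

Lemma aproj_is_scalable : scalable aproj.
Proof. by move=> a x; rewrite -[RHS]/(aqscale _ _) aqscaleE. Qed.
HB.instance Definition _ :=
  GRing.isScalable.Build F A aquot *:%R aproj aproj_is_scalable.

Lemma aproj_is_monoid_morphism : monoid_morphism aproj.
Proof. by split=> // x y; rewrite -[RHS]/(aqmul _ _) aqmulE. Qed.
HB.instance Definition _ :=
  GRing.isMonoidMorphism.Build A aquot aproj aproj_is_monoid_morphism.

Lemma aquot_scalerAl (a : F) (p q : aquot) : a *: (p * q) = (a *: p) * q.
Proof.
by rewrite -[p]areprK -[q]areprK -rmorphM -!linearZ -rmorphM /= scalerAl.
Qed.

Lemma aquot_scalerAr (a : F) (p q : aquot) : a *: (p * q) = p * (a *: q).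
Proof.
by rewrite -[p]areprK -[q]areprK -rmorphM -!linearZ -rmorphM /= scalerAr.
Qed.

Lemma aproj_gen g : G g -> aproj g = 0.
Proof.
by move=> Gg; apply/eqP; rewrite -(raddf0 aproj) aproj_eq subr0 mem_ideal_gen.
Qed.

Lemma ideal_gen_ker (B : pzRingType) (f : {rmorphism A -> B}) :
  (forall g, G g -> f g = 0) -> forall x, x \in ideal_gen G -> f x = 0.
Proof.
move=> fG; apply: ideal_gen_ind => //; split=> [|x y fx fy|a x fx|a x fx].
- exact: rmorph0.
- by rewrite rmorphD fx fy addr0.
- by rewrite rmorphM fx mulr0.
- by rewrite rmorphM fx mul0r.
Qed.

Lemma aquot_nonzero (B : nzRingType) (f : {rmorphism A -> B}) :
  (forall g, G g -> f g = 0) -> (1 : aquot) != 0.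
Proof.
move=> fG; apply/eqP=> /eqP; rewrite -(rmorph1 aproj) -(raddf0 aproj) aproj_eq.
by rewrite subr0 => /(ideal_gen_ker fG)/eqP; rewrite rmorph1 oner_eq0.
Qed.

Section Lift.
Variables (B : pzRingType) (f : {rmorphism A -> B}).

Definition aqlift (q : aquot) : B := f (arepr q).

Hypothesis fG : forall g, G g -> f g = 0.

Lemma aqliftE x : aqlift (aproj x) = f x.
Proof.
by apply/eqP; rewrite -subr_eq0 -rmorphB (ideal_gen_ker fG (arepr_proj x)).
Qed.

Lemma aqlift_is_zmod_morphism : zmod_morphism aqlift.
Proof.
by move=> p q; rewrite -[p]areprK -[q]areprK -rmorphB !aqliftE rmorphB.
Qed.

Lemma aqlift_is_monoid_morphism : monoid_morphism aqlift.
Proof.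
split=> [|p q]; first by rewrite -(rmorph1 aproj) aqliftE rmorph1.
by rewrite -[p]areprK -[q]areprK -rmorphM !aqliftE rmorphM.
Qed.

Definition aqlift_rmorphism : {rmorphism aquot -> B} :=
  HB.pack aqlift
    (GRing.isZmodMorphism.Build aquot B aqlift aqlift_is_zmod_morphism)
    (GRing.isMonoidMorphism.Build aquot B aqlift aqlift_is_monoid_morphism).

End Lift.

Section LinearLift.
Variables (B : algType F) (f : {lrmorphism A -> B}).
Hypothesis fG : forall g, G g -> f g = 0.

Lemma aqlift_is_scalable : scalable (aqlift f).
Proof.
move=> a q; rewrite -[q]areprK.
rewrite -[a *: aproj _](aproj_is_scalable a (arepr q)) !(aqliftE fG).
exact: linearZ.
Qed.

End LinearLift.

End AlgebraQuotient.

Section FreeModule.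
Variables (F : fieldType) (K : choiceType) (W : lmodType F) (f : K -> W).

Definition mlin (g : {malg F[K]}) : W := \sum_(k <- msupp g) g@_k *: f k.

Lemma mlinEw (d : {fset K}) g : (msupp g `<=` d)%fset ->
  mlin g = \sum_(k <- d) g@_k *: f k.
Proof.
move=> le; rewrite [LHS](big_fset_incl _ le) => //= x xd /mcoeff_outdom ->.
by rewrite scale0r.
Qed.

Lemma mlinU k : mlin << k >> = f k.
Proof. by rewrite (mlinEw msuppU_le) big_seq_fset1 mcoeffUU scale1r. Qed.

Lemma mlin_is_linear : linear mlin.
Proof.
move=> a g h; pose d := (msupp g `|` msupp h `|` msupp (a *: g + h))%fset.
rewrite !(@mlinEw d) ?fsubsetUr //; first last.
- by rewrite /d -fsetUA fsubsetUl.
- by rewrite /d [(msupp g `|` _)%fset]fsetUC -fsetUA fsubsetUl.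
rewrite scaler_sumr -big_split /=; apply: eq_bigr => k _.
by rewrite mcoeffD mcoeffZ scalerDl scalerA.
Qed.
HB.instance Definition _ :=
  GRing.isLinear.Build F {malg F[K]} W *:%R mlin mlin_is_linear.

End FreeModule.

Lemma malg_ind (F : fieldType) (K : choiceType) (P : {malg F[K]} -> Prop) :
  P 0 -> (forall a k g, P g -> P (a *: << k >> + g)) -> forall g, P g.
Proof.
move=> P0 PD g.
suff: forall s : seq K, P (\sum_(k <- s) << g@_k *g k >>).
  by move/(_ (msupp g)); rewrite -monalgE.
elim=> [|k s IHs].
  by rewrite big_nil.
rewrite big_cons; suff -> : << g@_k *g k >> = g@_k *: (<< k >> : {malg F[K]}).
  exact: PD.
by apply/malgP=> l; rewrite mcoeffZ !mcoeffU mulrnAr mulr1.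
Qed.

Section Functional.
Variables (F : fieldType) (V : lmodType F).
Local Open Scope classical_set_scope.

Lemma exists_functional (v : V) : v != 0 ->
  exists f : V -> F^o, linear f /\ f v = 1.
Proof.
move=> v_neq0.
pose P : set (set V) :=
  [set W | (forall a x y, W x -> W y -> W (a *: x + y)) /\ ~ W v].
have [|W [[WD Wv] Wmax]] := @Zorn_bigcup V P.
  move=> C CP Ctot; split=> [a x y [X CX Xx] [Y CY Yy]|[X /CP[_ Xv]]//].
  have [XY|YX] := Ctot _ _ CX CY.
    by exists Y => //; apply: (CP _ CY).1 => //; apply: XY.
  by exists X => //; apply: (CP _ CX).1 => //; apply: YX.
have W0 : W 0.
  apply: contrapT => nW0; apply: (Wmax [set 0]); last first.
    split=> [a x y -> ->|v0]; first by rewrite /= scaler0 addr0.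
    by rewrite (v0 : v = 0) eqxx in v_neq0.
  have WE x : ~ W x.
    by move=> Wx; apply: nW0; rewrite -(addNr x) -scaleN1r; apply: WD.
  by split=> [x /WE//|/(_ 0 erefl)/WE].
have WZ a x : W x -> W (a *: x) by move=> Wx; rewrite -[_ *: _]addr0; apply: WD.
have coef x : exists c, W (x - c *: v).
  have [Wx|nWx] := pselect (W x); first by exists 0; rewrite scale0r subr0.
  pose B := [set y | exists a, W (y - a *: x)].
  have WB : W `<` B.
    split=> [y Wy|/(_ x)]; first by exists 0; rewrite scale0r subr0.
    by move=> BW; apply/nWx/BW; exists 1; rewrite scale1r subrr.
  have := Wmax _ WB; rewrite not_andE => -[|/contrapT[a Wa]].
    case=> a y z [b Wb] [c Wc]; exists (a * b + c).
    by rewrite scalerDl -scalerA opprD addrACA -scalerBr; apply: WD.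
  have a0 : a != 0 by apply: contra_notN Wv => /eqP a0; rewrite a0 scale0r subr0 in Wa.
  exists a^-1; have := WZ (- a^-1) _ Wa.
  by rewrite scalerBr !scaleNr scalerA mulVf // scale1r opprK addrC.
have [f fW] := choice coef.
have f_uniq x c : W (x - c *: v) -> f x = c.
  move=> Wc; apply: contra_notP Wv => /eqP; rewrite -subr_eq0 => fc.
  have := WD (-1) _ _ (fW x) Wc.
  rewrite scaleN1r opprB addrA subrK -scalerBl => /(WZ (f x - c)^-1).
  by rewrite scalerA mulVf // scale1r.
exists f; split=> [a x y|]; last first.
  by apply: f_uniq; rewrite scale1r subrr.
apply: (f_uniq _ (a * f x + f y)).
by rewrite scalerDl -scalerA opprD addrACA -scalerBr; apply: WD.
Qed.

End Functional.

Section TensorDef.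
Variables (F : fieldType) (U V : lmodType F).

Definition tensor_rel (g : {malg F[(U * V)%type]}) : Prop :=
  (exists a x x' y,
     g = << (a *: x + x', y) >> - (a *: << (x, y) >> + << (x', y) >>)) \/
  (exists a x y y',
     g = << (x, a *: y + y') >> - (a *: << (x, y) >> + << (x, y') >>)).

Definition tensor : Type := lquot tensor_rel.
HB.instance Definition _ := GRing.Lmodule.on tensor.

End TensorDef.

HB.lock Definition tens (F : fieldType) (U V : lmodType F) (u : U) (v : V) :
  tensor U V := lproj (@tensor_rel F U V) << (u, v) >>.
Canonical tens_unlock := Unlockable tens.unlock.

HB.lock Definition tlift (F : fieldType) (U V W : lmodType F)
    (f : U -> V -> W) (t : tensor U V) : W :=
  mlin (fun p => f p.1 p.2) (lrepr t).
Canonical tlift_unlock := Unlockable tlift.unlock.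

Arguments tens {F U V} u v.
Arguments tlift {F U V W} f t.

Section Tensor.
Variables (F : fieldType) (U V : lmodType F).
Local Notation tensor := (tensor U V).
Local Notation tensor_rel := (@tensor_rel F U V).
Local Notation tens := (@tens F U V).

Lemma tens_bilinear : bilinear_for *:%R *:%R tens.
Proof.
split=> [y a x x'|x a y y']; apply/eqP;
  rewrite -subr_eq0 tens.unlock -linearP -raddfB; apply/eqP/lproj_gen.
- by left; exists a, x, x', y.
- by right; exists a, x, y, y'.
Qed.


HB.instance Definition _ :=
  bilinear_isBilinear.Build F U V tensor *:%R *:%R tens tens_bilinear.

Lemma tensor_ind (P : tensor -> Prop) :
  P 0 -> (forall a u v t, P t -> P (a *: tens u v + t)) -> forall t, P t.
Proof.
move=> P0 PD t; rewrite -[t]lreprK.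
elim/malg_ind: (lrepr t) => [|a [u v] g Pg]; first by rewrite linear0.
by rewrite linearP; have := PD a u v _ Pg; rewrite tens.unlock.
Qed.

Section Lift.
Variable W : lmodType F.
Implicit Types f g : U -> V -> W.

Lemma eq_tlift f g : f =2 g -> tlift f =1 tlift g.
Proof. by move=> fg t; rewrite tlift.unlock; apply: eq_bigr => k _; rewrite fg. Qed.

Lemma tlift_funP a f g t :
  tlift (fun u v => a *: f u v + g u v) t = a *: tlift f t + tlift g t.
Proof.
rewrite tlift.unlock /mlin scaler_sumr -big_split /=; apply: eq_bigr => k _.
by rewrite scalerDr !scalerA mulrC.
Qed.

Variable f : U -> V -> W.
Hypothesis f_bilinear : bilinear_for *:%R *:%R f.

Lemma tlift_proj (m : {malg F[(U * V)%type]}) :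
  tlift f (lproj tensor_rel m) = mlin (fun p => f p.1 p.2) m.
Proof.
rewrite tlift.unlock; suff K z : z \in span tensor_rel -> mlin (fun p => f p.1 p.2) z = 0.
  by apply/eqP; rewrite -subr_eq0 -raddfB; apply/eqP/K/lrepr_proj.
move: z; apply: span_ind => [|_ [[a [x [x' [y ->]]]]|[a [x [y [y' ->]]]]]].
- split=> [|a x y fx fy]; first exact: linear0.
  by rewrite linearP /= fx fy scaler0 addr0.
- rewrite linearB linearP /= !mlinU /=.
  by have /= -> := f_bilinear.1 y a x x'; rewrite subrr.
- rewrite linearB linearP /= !mlinU /=.
  by have /= -> := f_bilinear.2 x a y y'; rewrite subrr.
Qed.

Lemma tliftE u v : tlift f (tens u v) = f u v.
Proof. by rewrite tens.unlock tlift_proj mlinU. Qed.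

Lemma tlift_linear : linear (tlift f).
Proof.
move=> a s t; rewrite -[s]lreprK -[t]lreprK -linearP !tlift_proj.
exact: linearP.
Qed.

Lemma tlift0 : tlift f 0 = 0.
Proof. by rewrite -(raddf0 (lproj tensor_rel)) tlift_proj linear0. Qed.

Lemma tlift_uniq (h : {linear tensor -> W}) :
  (forall u v, h (tens u v) = f u v) -> h =1 tlift f.
Proof.
move=> hf; elim/tensor_ind=> [|a u v t IHt].
  by rewrite linear0 tlift0.
by rewrite linearP tlift_linear hf tliftE IHt.
Qed.

End Lift.

End Tensor.

Notation "u '*t' v" := (tens u v) (at level 40, left associativity).

HB.lock Definition tmul (F : fieldType) (A B : algType F)
    (s t : tensor A B) : tensor A B :=
  tlift (fun a b => tlift (fun c d => (a * c : A) *t (b * d : B)) t) s.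
Canonical tmul_unlock := Unlockable tmul.unlock.

Section TensorProductAlgebra.
Variables (F : fieldType) (A B : algType F).
Local Notation AB := (tensor A B).
Local Notation tmul := (@tmul F A B).

Fact tmul_bilinear_inner a b :
  bilinear_for *:%R *:%R (fun c d => (a * c : A) *t (b * d : B)).
Proof.
by split=> [d e c c'|c e d d']; rewrite mulrDr -scalerAr ?linearPl ?linearPr.
Qed.

Fact tmul_bilinear_outer t :
  bilinear_for *:%R *:%R
    (fun a b => tlift (fun c d => (a * c : A) *t (b * d : B)) t).
Proof.
split=> [b e a a'|a e b b']; rewrite -tlift_funP; apply: eq_tlift => c d.
- by rewrite mulrDl -scalerAl linearPl.
- by rewrite mulrDl -scalerAl linearPr.
Qed.

Lemma tmulE a b c d : tmul (a *t b) (c *t d) = (a * c : A) *t (b * d : B).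
Proof.
by rewrite tmul.unlock (tliftE (tmul_bilinear_outer _)) (tliftE (tmul_bilinear_inner _ _)).
Qed.

Lemma tmulPl a s s' t : tmul (a *: s + s') t = a *: tmul s t + tmul s' t.
Proof. by rewrite tmul.unlock; apply: (tlift_linear (tmul_bilinear_outer t)). Qed.

Lemma tmulPr a s t t' : tmul s (a *: t + t') = a *: tmul s t + tmul s t'.
Proof.
rewrite tmul.unlock -tlift_funP; apply: eq_tlift => u v.
exact: (tlift_linear (tmul_bilinear_inner u v)).
Qed.

Fact tmul0t t : tmul 0 t = 0.
Proof. by have := tmulPl (-1) 0 0 t; rewrite scaler0 addr0 scaleN1r addNr. Qed.
Fact tmult0 t : tmul t 0 = 0.
Proof. by have := tmulPr (-1) t 0 0; rewrite scaler0 addr0 scaleN1r addNr. Qed.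

Fact tmulA : associative tmul.
Proof.
elim/tensor_ind=> [|x a b s IHs] t r; first by rewrite !tmul0t.
rewrite !tmulPl IHs; congr (_ *: _ + _).
elim/tensor_ind: t {IHs} => [|y c d t IHt]; first by rewrite !(tmul0t, tmult0).
rewrite !(tmulPl, tmulPr) IHt; congr (_ *: _ + _).
elim/tensor_ind: r {IHt} => [|z e f r IHr]; first by rewrite !tmult0.
by rewrite !tmulPr IHr !tmulE !mulrA.
Qed.

Fact tmul1t : left_id ((1 : A) *t (1 : B)) tmul.
Proof.
elim/tensor_ind=> [|x a b s IHs]; first by rewrite tmult0.
by rewrite tmulPr IHs tmulE !mul1r.
Qed.

Fact tmult1 : right_id ((1 : A) *t (1 : B)) tmul.
Proof.
elim/tensor_ind=> [|x a b s IHs]; first by rewrite tmul0t.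
by rewrite tmulPl IHs tmulE !mulr1.
Qed.

Fact tmulDl : left_distributive tmul +%R.
Proof. by move=> s t r; have := tmulPl 1 s t r; rewrite !scale1r. Qed.
Fact tmulDr : right_distributive tmul +%R.
Proof. by move=> s t r; have := tmulPr 1 s t r; rewrite !scale1r. Qed.

HB.instance Definition _ := GRing.Zmodule_isPzRing.Build AB
  tmulA tmul1t tmult1 tmulDl tmulDr.

Fact tensor_nonzero : (1 : AB) != 0.
Proof.
have [f [f_lin f1]] := exists_functional (oner_neq0 A).
have [g [g_lin g1]] := exists_functional (oner_neq0 B).
have fg_bilinear : bilinear_for *:%R *:%R (fun a b => f a * g b : F^o).
  split=> [b e a a'|a e b b'].
    by rewrite f_lin mulrDl -scalerAl.
  by rewrite g_lin mulrDr -scalerAr.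
apply/eqP=> /(congr1 (tlift (fun a b => f a * g b : F^o))).
rewrite (tlift0 fg_bilinear) (tliftE fg_bilinear) f1 g1 mulr1.
exact/eqP/oner_neq0.
Qed.

HB.instance Definition _ := GRing.PzSemiRing_isNonZero.Build AB tensor_nonzero.

Lemma tensM a b c d : (a *t b) * (c *t d) = (a * c : A) *t (b * d : B).
Proof. exact: tmulE. Qed.

Lemma tens1 : (1 : A) *t (1 : B) = 1.
Proof. by []. Qed.

Fact tensor_scalerAl (x : F) (s t : AB) : x *: (s * t) = (x *: s) * t.
Proof. by have := tmulPl x s 0 t; rewrite tmul0t !addr0 => /esym. Qed.
Fact tensor_scalerAr (x : F) (s t : AB) : x *: (s * t) = s * (x *: t).
Proof. by have := tmulPr x s t 0; rewrite tmult0 !addr0 => /esym. Qed.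

HB.instance Definition _ := GRing.Lmodule_isLalgebra.Build F AB tensor_scalerAl.
HB.instance Definition _ := GRing.Lalgebra_isAlgebra.Build F AB tensor_scalerAr.

End TensorProductAlgebra.

Section TensorMaps.
Variables (F : fieldType) (U V W U' V' : lmodType F).

Definition tmap (f : U -> U') (g : V -> V') : tensor U V -> tensor U' V' :=
  tlift (fun u v => f u *t g v).

Definition tswap : tensor U V -> tensor V U := tlift (fun u v => v *t u).

Definition tassoc : tensor (tensor U V) W -> tensor U (tensor V W) :=
  tlift (fun t w => tlift (fun u v => u *t (v *t w)) t).

Lemma tmapE (f : {linear U -> U'}) (g : {linear V -> V'}) u v :
  tmap f g (u *t v) = f u *t g v.
Proof.
rewrite /tmap tliftE //.
by split=> [v' a u1 u2|u' a v1 v2]; rewrite linearP ?linearPl ?linearPr.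
Qed.

Lemma tswapE u v : tswap (u *t v) = v *t u.
Proof.
by rewrite /tswap tliftE //; split=> [v' a u1 u2|u' a v1 v2];
   rewrite ?linearPl ?linearPr.
Qed.

Lemma tassocE u v w : tassoc ((u *t v) *t w) = u *t (v *t w).
Proof.
have inner (w' : W) : bilinear_for *:%R *:%R (fun (u : U) (v : V) => u *t (v *t w')).
  by split=> [v' a u1 u2|u' a v1 v2]; rewrite !linearPl ?linearPr.
rewrite /tassoc !tliftE //; split=> [w' a t1 t2|t a w1 w2].
  by rewrite /= (tlift_linear (inner w')).
by rewrite -tlift_funP; apply: eq_tlift => u' v'; rewrite !linearPr.
Qed.

End TensorMaps.

Section HopfAlgebra.
Variables (F : fieldType) (H : algType F).
Variables (Delta : {lrmorphism H -> tensor H H}) (eps : {lrmorphism H -> F^o}).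
Variable (S : {linear H -> H}).

Definition coassociative : Prop :=
  forall h, tassoc (tmap Delta idfun (Delta h)) = tmap idfun Delta (Delta h).

(* The identifications F (x) H = H = H (x) F are a (x) h |-> a *: h and
   h (x) a |-> a *: h. *)
Definition counital : Prop :=
  forall h, tlift (fun a b => eps a *: b) (Delta h) = h /\
            tlift (fun a b => eps b *: a) (Delta h) = h.

Definition antipodal : Prop :=
  forall h, tlift (fun a b => S a * b) (Delta h) = (eps h)%:A /\
            tlift (fun a b => a * S b) (Delta h) = (eps h)%:A.

Definition cocommutative : Prop := forall h, tswap (Delta h) = Delta h.

(* That comultiplication and counit are algebra morphisms is part of the types
   of Delta and eps. *)
Definition hopf_algebra : Prop := [/\ coassociative, counital & antipodal].

Definition cocommutative_hopf_algebra : Prop := hopf_algebra /\ cocommutative.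

End HopfAlgebra.

Section FreeAlgebra.
Variables (F : fieldType) (X : choiceType).

Definition free_alg : Type := {malg F[{fmonom X}]}.
HB.instance Definition _ := GRing.Lalgebra.on free_alg.

Definition letter (x : X) : free_alg := << fmu x >>.

Fact malg_constC (a : F) (g : {malg F[{fmonom X}]}) :
  g * a%:MP = a%:MP * g.
Proof.
rewrite [LHS]fgmulgU [RHS]fgmulUg; apply: eq_bigr => k _.
by rewrite mul1m mulm1 mulrC.
Qed.

Fact free_alg_scalerAr (a : F) (g h : free_alg) : a *: (g * h) = g * (a *: h).
Proof.
rewrite -[RHS]/(g * (a *: (h : {malg F[{fmonom X}]}))).
by rewrite -mul_malgC mulrA -malg_constC -mulrA mul_malgC.
Qed.
HB.instance Definition _ :=
  GRing.Lalgebra_isAlgebra.Build F free_alg free_alg_scalerAr.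

Definition const_coef (g : free_alg) : F :=
  mcoeff mone (g : {malg F[{fmonom X}]}).
HB.instance Definition _ := GRing.RMorphism.copy const_coef (mcoeff mone).

Lemma const_coef_letter x : const_coef (letter x) = 0.
Proof. by rewrite /const_coef /letter mcoeffU -[mone]/(fmone X) fmoneE fmuE. Qed.

Lemma const_coefZ a g : const_coef (a *: g) = a * const_coef g.
Proof. exact: mcoeffZ. Qed.

Definition word (k : {fmonom X}) : free_alg := << k >>.

Lemma free_alg_ind (P : free_alg -> Prop) :
  P 0 -> (forall a k g, P g -> P (a *: word k + g)) -> forall g, P g.
Proof. exact: malg_ind. Qed.

Section FreeLift.
Variables (B : algType F) (f : X -> B).

Definition word_prod (k : {fmonom X}) : B := \prod_(x <- k) f x.
Definition free_lift (g : free_alg) : B :=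
  mlin word_prod (g : {malg F[{fmonom X}]}).

Lemma free_lift_letter x : free_lift (letter x) = f x.
Proof. by rewrite /free_lift mlinU /word_prod fmuE big_seq1. Qed.

Lemma free_lift_is_linear : linear free_lift.
Proof. exact: mlin_is_linear. Qed.
HB.instance Definition _ :=
  GRing.isLinear.Build F free_alg B *:%R free_lift free_lift_is_linear.

Lemma free_lift_is_monoid_morphism : monoid_morphism free_lift.
Proof.
split=> [|g h]; first by rewrite /free_lift mlinU /word_prod -[mone]/(fmone X) fmoneE big_nil.
have PL := free_lift_is_linear.
elim/free_alg_ind: g => [|a k g IHg]; first by rewrite mul0r !linear0 mul0r.
rewrite mulrDl -scalerAl !PL IHg mulrDl -scalerAl; congr (_ *: _ + _).
elim/free_alg_ind: h {IHg} => [|b l h IHh]; first by rewrite mulr0 !linear0 mulr0.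
rewrite mulrDr -scalerAr !PL IHh mulrDr -scalerAr; congr (_ *: _ + _).
rewrite /free_lift [X in mlin _ X]fgmulUU mulr1 !mlinU /word_prod.
by rewrite -[mmul _ _]/(fmmul _ _) fmmulE big_cat.
Qed.
HB.instance Definition _ := GRing.isMonoidMorphism.Build free_alg B free_lift
  free_lift_is_monoid_morphism.

End FreeLift.

End FreeAlgebra.

Section TensorAlgebra.
Variables (F : fieldType) (V : lmodType F).

(* T(V) is presented as words in the letters V modulo multilinearity: the span
   of the words of length n is the n-th tensor power of V. *)
Definition tensor_alg_rel (g : free_alg F V) : Prop :=
  exists a x y, g = letter F (a *: x + y) - (a *: letter F x + letter F y).

Definition tensor_alg : Type := aquot tensor_alg_rel.
HB.instance Definition _ := GRing.PzRing.on tensor_alg.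
HB.instance Definition _ := GRing.Lmodule.on tensor_alg.

Lemma const_coef_tensor_alg_rel g : tensor_alg_rel g -> const_coef g = 0.
Proof.
move=> [a [x [y ->]]]; rewrite rmorphB rmorphD /= const_coefZ.
by rewrite !const_coef_letter mulr0 addr0 subr0.
Qed.

HB.instance Definition _ := GRing.PzSemiRing_isNonZero.Build tensor_alg
  (aquot_nonzero const_coef_tensor_alg_rel).
HB.instance Definition _ := GRing.Lmodule_isLalgebra.Build F tensor_alg
  (@aquot_scalerAl _ _ tensor_alg_rel).
HB.instance Definition _ := GRing.Lalgebra_isAlgebra.Build F tensor_alg
  (@aquot_scalerAr _ _ tensor_alg_rel).

Definition tgen (x : V) : tensor_alg := aproj tensor_alg_rel (letter F x).

Lemma tgen_is_linear : linear tgen.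
Proof.
move=> a x y; apply/eqP; rewrite -subr_eq0 -linearP -raddfB.
by apply/eqP/aproj_gen; exists a, x, y.
Qed.
HB.instance Definition _ :=
  GRing.isLinear.Build F V tensor_alg *:%R tgen tgen_is_linear.

Lemma tensor_alg_ext (B : algType F) (g h : {lrmorphism tensor_alg -> B}) :
  (forall x, g (tgen x) = h (tgen x)) -> g =1 h.
Proof.
move=> gh q; rewrite -[q]areprK; elim/free_alg_ind: (arepr q) => [|a k u IHu].
  by rewrite !raddf0.
have projP (b : F) v w : aproj tensor_alg_rel (b *: v + w) =
    b *: (aproj tensor_alg_rel v : tensor_alg) + aproj tensor_alg_rel w.
  exact: linearP.
rewrite projP linearP [RHS]linearP; congr (_ *: _ + _); last exact: IHu.
case: k => k.
elim: k => [|x k IHk].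
  have -> : @word F V (FMonom [::]) = 1.
    exact: (congr1 (@word F V) (esym (fmoneE V))).
  have -> : aproj tensor_alg_rel 1 = (1 : tensor_alg) by [].
  by rewrite !rmorph1.
have -> : word F (FMonom (x :: k)) = letter F x * word F (FMonom k).
  rewrite [RHS]fgmulUU mulr1 /word; congr << _ >>.
  by rewrite -[mmul _ _]/(fmmul _ _) fmmulE fmuE.
have -> : aproj tensor_alg_rel (letter F x * word F (FMonom k)) =
    tgen x * (aproj tensor_alg_rel (word F (FMonom k)) : tensor_alg).
  exact: rmorphM.
by rewrite [LHS]rmorphM [RHS]rmorphM; congr (_ * _); [apply: gh | apply: IHk].
Qed.

Lemma tensor_alg_universal (B : algType F) (f : {linear V -> B}) :
  exists2 g : {lrmorphism tensor_alg -> B}, (forall x, g (tgen x) = f x) &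
    forall h : {lrmorphism tensor_alg -> B},
      (forall x, h (tgen x) = f x) -> h =1 g.
Proof.
have fG u : tensor_alg_rel u -> free_lift f u = 0.
  move=> [a [x [y ->]]]; rewrite linearB linearP /= !free_lift_letter.
  by rewrite linearP subrr.
pose g0 : tensor_alg -> B := aqlift (free_lift f).
pose g : {lrmorphism tensor_alg -> B} := HB.pack g0
  (GRing.isZmodMorphism.Build tensor_alg B g0 (aqlift_is_zmod_morphism fG))
  (GRing.isMonoidMorphism.Build tensor_alg B g0 (aqlift_is_monoid_morphism fG))
  (GRing.isScalable.Build F tensor_alg B *:%R g0 (aqlift_is_scalable fG)).
have gE x : g (tgen x) = f x.
  exact: etrans (aqliftE fG _) (free_lift_letter _ _).
exists g => // h hE; apply: tensor_alg_ext => x.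
by rewrite hE gE.
Qed.

Definition tensor_alg_aug : {rmorphism tensor_alg -> F} :=
  aqlift_rmorphism const_coef_tensor_alg_rel.

Lemma tensor_alg_aug_gen x : tensor_alg_aug (tgen x) = 0.
Proof.
exact: etrans (aqliftE const_coef_tensor_alg_rel _) (const_coef_letter _ _).
Qed.

End TensorAlgebra.

Definition left_leibniz (F : fieldType) (L : lmodType F) (mul : L -> L -> L) :
  Prop := forall x y z, mul x (mul y z) = mul (mul x y) z + mul y (mul x z).

Section WeakEnvelopingAlgebra.
Variables (F : fieldType) (L : lmodType F) (mul : L -> L -> L).

(* The external direct sum of the two copies of L is L * L; l and r below are
   its two injections, followed by the inclusion in the tensor algebra. *)
Definition UL_rel (g : tensor_alg (L * L)%type) : Prop :=
  let l (x : L) := tgen ((x, 0) : L * L) in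
  let r (x : L) := tgen ((0, x) : L * L) in
  (exists x y, g = l x * l y - l y * l x - l (mul x y)) \/
  (exists x y, g = l x * r y - r y * l x - r (mul x y)).

Definition UL_weak : Type := aquot UL_rel.
HB.instance Definition _ := GRing.PzRing.on UL_weak.
HB.instance Definition _ := GRing.Lmodule.on UL_weak.

Lemma tensor_alg_aug_UL_rel g : UL_rel g -> tensor_alg_aug _ g = 0.
Proof.
by move=> [] [x [y ->]]; rewrite !rmorphB !rmorphM !tensor_alg_aug_gen
  !mulr0 !subr0.
Qed.

HB.instance Definition _ := GRing.PzSemiRing_isNonZero.Build UL_weak
  (aquot_nonzero tensor_alg_aug_UL_rel).
HB.instance Definition _ := GRing.Lmodule_isLalgebra.Build F UL_weak
  (@aquot_scalerAl _ _ UL_rel).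
HB.instance Definition _ := GRing.Lalgebra_isAlgebra.Build F UL_weak
  (@aquot_scalerAr _ _ UL_rel).

Definition ell (x : L) : UL_weak := aproj UL_rel (tgen ((x, 0) : L * L)).
Definition rr (x : L) : UL_weak := aproj UL_rel (tgen ((0, x) : L * L)).

Definition UL_comul (Delta : {lrmorphism UL_weak -> tensor UL_weak UL_weak}) :
  Prop := forall x, Delta (ell x) = ell x *t 1 + 1 *t ell x /\
                    Delta (rr x) = rr x *t 1 + 1 *t rr x.

Definition UL_counit (eps : {lrmorphism UL_weak -> F^o}) : Prop :=
  forall x, eps (ell x) = 0 /\ eps (rr x) = 0.

Definition UL_antipode (S : {linear UL_weak -> UL_weak}) : Prop :=
  [/\ S 1 = 1, forall a b, S (a * b) = S b * S a
     & forall x, S (ell x) = - ell x /\ S (rr x) = - rr x].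

End WeakEnvelopingAlgebra.

(* Main.v *)
(* UL_weak(L) is generated as an algebra by the image of the direct sum L * L,
   and linear maps from L * L to an algebra B that respect the two families of
   commutator relations extend to algebra morphisms UL_weak(L) -> B. Primitive
   tensors u (x) 1 + 1 (x) u are closed under commutators, so the relations
   hold for Delta; they hold trivially for eps = 0 on generators; and they hold for
   x |-> - x with values in the converse algebra, which gives S. The two sides
   of coassociativity and of cocommutativity are algebra morphisms, hence are
   compared on primitive generators. The counit and antipode identities follow
   by induction on words: passing from h to x h, for a generator x, changes the
   convolutions eps * id and id * eps by left multiplication by x, sends S * id
   to 0 and changes id * S into its commutator with x. *)
From HB Require Import structures.
Require Import Defs.
From mathcomp Require Import all_boot all_algebra monalg.
Import GRing.Theory.
Local Open Scope ring_scope.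

Set Implicit Arguments.
Unset Strict Implicit.
Unset Printing Implicit Defensive.

(** * Swap, associator and tensor products of morphisms as algebra morphisms *)

Section TensorMultiplicative.
Variable F : fieldType.

(** Both sides are bilinear in [u] and [v], so a spanning set [D] suffices; that [D] spans is stated
    as an induction principle. *)
Lemma linear_mulP (A B : algType F) (f : {linear A -> B}) (D : A -> Prop) :
  (forall P : A -> Prop, P 0 -> (forall a u v, P u -> P v -> P (a *: u + v)) ->
     (forall u, D u -> P u) -> forall u, P u) ->
  (forall u v, D u -> D v -> f (u * v) = f u * f v) ->
  forall u v, f (u * v) = f u * f v.
Proof.
move=> spanD fM u v; move: u; apply: (spanD) => [|a u1 u2 IH1 IH2|u Du].
- by rewrite mul0r linear0 mul0r.
- by rewrite mulrDl -scalerAl !linearP /= IH1 IH2 mulrDl -scalerAl.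
move: v; apply: spanD => [|a v1 v2 IH1 IH2|v Dv].
- by rewrite mulr0 linear0 mulr0.
- by rewrite mulrDr -scalerAr !linearP /= IH1 IH2 mulrDr -scalerAr.
exact: fM.
Qed.

Lemma tensor_mulP (A B C : algType F) (f : {linear tensor A B -> C}) :
  (forall a b c d, f ((a *t b) * (c *t d)) = f (a *t b) * f (c *t d)) ->
  forall s t, f (s * t) = f s * f t.
Proof.
move=> fM; apply: (linear_mulP (D := fun t => exists a b, t = a *t b)).
  move=> P P0 PD Pt; elim/tensor_ind=> // a u v t Pt'; apply: PD => //.
  by apply: Pt; exists u, v.
by move=> _ _ [a [b ->]] [c [d ->]].
Qed.

Lemma tswap_bilinear (U V : lmodType F) :
  bilinear_for *:%R *:%R (fun (u : U) (v : V) => v *t u).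
Proof. by split=> [v a u1 u2|u a v1 v2]; rewrite ?linearPl ?linearPr. Qed.

Lemma tswap_linear (U V : lmodType F) : linear (@tswap F U V).
Proof. exact: tlift_linear (@tswap_bilinear U V). Qed.
HB.instance Definition _ (U V : lmodType F) :=
  GRing.isLinear.Build F (tensor U V) (tensor V U) *:%R (@tswap F U V)
    (@tswap_linear U V).

Lemma tassoc_linear (U V W : lmodType F) : linear (@tassoc F U V W).
Proof.
have inner (w' : W) :
    bilinear_for *:%R *:%R (fun (u : U) (v : V) => u *t (v *t w')).
  by split=> [v' a u1 u2|u' a v1 v2]; rewrite !linearPl ?linearPr.
rewrite /tassoc; apply: tlift_linear; split=> [w' a t1 t2|t a w1 w2].
  by rewrite /= (tlift_linear (inner w')).
by rewrite -tlift_funP; apply: eq_tlift => u' v'; rewrite !linearPr.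
Qed.
HB.instance Definition _ (U V W : lmodType F) :=
  GRing.isLinear.Build F _ _ *:%R (@tassoc F U V W) (@tassoc_linear U V W).

Lemma tmap_bilinear (U V U' V' : lmodType F)
    (f : {linear U -> U'}) (g : {linear V -> V'}) :
  bilinear_for *:%R *:%R (fun u v => f u *t g v).
Proof.
by split=> [v a u1 u2|u a v1 v2]; rewrite linearP ?linearPl ?linearPr.
Qed.

Lemma tmap_linear (U V U' V' : lmodType F)
    (f : {linear U -> U'}) (g : {linear V -> V'}) : linear (tmap f g).
Proof. exact: tlift_linear (tmap_bilinear f g). Qed.
HB.instance Definition _ (U V U' V' : lmodType F)
    (f : {linear U -> U'}) (g : {linear V -> V'}) :=
  GRing.isLinear.Build F _ _ *:%R (tmap f g) (tmap_linear f g).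

Lemma tswapM (A B : algType F) (s t : tensor A B) :
  tswap (s * t) = tswap s * tswap t.
Proof.
apply: (tensor_mulP (f := @tswap F A B)) => a b c d.
by rewrite /= tensM !tswapE tensM.
Qed.

Lemma tensor3_ind (U V W : lmodType F) (P : tensor (tensor U V) W -> Prop) :
  P 0 -> (forall a s t, P s -> P t -> P (a *: s + t)) ->
  (forall u v w, P ((u *t v) *t w)) -> forall t, P t.
Proof.
move=> P0 PD Pt; elim/tensor_ind=> // a u w t Pt'; apply: (PD) => // {t Pt'}.
elim/tensor_ind: u => [|b u v t Pt']; first by rewrite linear0l.
by rewrite linearPl; apply: PD; [apply: Pt | apply: Pt'].
Qed.

Lemma tassocM (A B C : algType F) (s t : tensor (tensor A B) C) :
  tassoc (s * t) = tassoc s * tassoc t.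
Proof.
pose ABC : algType F := (tensor (tensor A B) C : algType F).
pose A_BC : algType F := (tensor A (tensor B C) : algType F).
pose f : {linear ABC -> A_BC} := @tassoc F A B C.
refine (@linear_mulP ABC A_BC f
  (fun u => exists a b c, u = (a *t b) *t c) _ _ s t).
  move=> P P0 PD Pt; apply: tensor3_ind => // a b c.
  by apply: Pt; exists a, b, c.
move=> _ _ [a [b [c ->]]] [a' [b' [c' ->]]].
by rewrite /f /= [in LHS]tensM [in LHS]tensM !tassocE !tensM.
Qed.

Lemma tmapM (A B A' B' : algType F) (f : {lrmorphism A -> A'})
    (g : {lrmorphism B -> B'}) (s t : tensor A B) :
  tmap f g (s * t) = tmap f g s * tmap f g t.
Proof.
apply: (tensor_mulP (f := tmap f g)) => a b c d.
by rewrite /= tensM !tmapE tensM !rmorphM.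
Qed.

Lemma tswap_monoid_morphism (A B : algType F) : monoid_morphism (@tswap F A B).
Proof. by split; [rewrite -tens1 tswapE | apply: tswapM]. Qed.
HB.instance Definition _ (A B : algType F) :=
  GRing.isMonoidMorphism.Build (tensor A B) (tensor B A) (@tswap F A B)
    (@tswap_monoid_morphism A B).

Lemma tassoc_monoid_morphism (A B C : algType F) :
  monoid_morphism (@tassoc F A B C).
Proof. by split; [rewrite -!tens1 tassocE | apply: tassocM]. Qed.
HB.instance Definition _ (A B C : algType F) :=
  GRing.isMonoidMorphism.Build (tensor (tensor A B) C) (tensor A (tensor B C))
    (@tassoc F A B C)
    (@tassoc_monoid_morphism A B C).

Lemma tmap_monoid_morphism (A B A' B' : algType F) (f : {lrmorphism A -> A'})
    (g : {lrmorphism B -> B'}) : monoid_morphism (tmap f g).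
Proof. by split; [rewrite -!tens1 tmapE !rmorph1 | apply: tmapM]. Qed.
HB.instance Definition _ (A B A' B' : algType F) (f : {lrmorphism A -> A'})
    (g : {lrmorphism B -> B'}) :=
  GRing.isMonoidMorphism.Build (tensor A B) (tensor A' B') (tmap f g)
    (tmap_monoid_morphism f g).

End TensorMultiplicative.

(** * Hopf axioms for an algebra generated by primitive elements *)

Section AlgebraGenerators.
Variables (F : fieldType) (H : algType F) (X : Type) (x_ : X -> H).

(* Induction principle expressing that the family x_ generates H as a unital
   algebra: H is spanned by the words in the x_ i. *)
Definition alg_generators : Prop := forall P : H -> Prop, P 1 ->
  (forall a u v, P u -> P v -> P (a *: u + v)) ->
  (forall i u, P u -> P (x_ i * u)) -> forall u, P u.

Hypothesis genP : alg_generators.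

Lemma lrmorphism_ext (B : algType F) (f g : {lrmorphism H -> B}) :
  (forall i, f (x_ i) = g (x_ i)) -> f =1 g.
Proof.
move=> fg; apply: genP => [|a u v IHu IHv|i u IHu]; first by rewrite !rmorph1.
  by rewrite !linearP /= IHu IHv.
by rewrite !rmorphM /= fg IHu.
Qed.

Lemma antimorphism_ext (S T : {linear H -> H}) :
    S 1 = 1 -> (forall u v, S (u * v) = S v * S u) ->
    T 1 = 1 -> (forall u v, T (u * v) = T v * T u) ->
  (forall i, S (x_ i) = T (x_ i)) -> S =1 T.
Proof.
move=> S1 SM T1 TM ST; apply: genP => [|a u v IHu IHv|i u IHu].
- by rewrite S1 T1.
- by rewrite !linearP /= IHu IHv.
- by rewrite SM TM ST IHu.
Qed.

Section PrimitiveGenerators.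
Variables (Delta : {lrmorphism H -> tensor H H}) (eps : {lrmorphism H -> F^o}).
Variable (S : {linear H -> H}).
Hypothesis Delta_x : forall i, Delta (x_ i) = x_ i *t 1 + 1 *t x_ i.
Hypothesis eps_x : forall i, eps (x_ i) = 0.
Hypothesis S1 : S 1 = 1.
Hypothesis SM : forall u v, S (u * v) = S v * S u.
Hypothesis S_x : forall i, S (x_ i) = - x_ i.

Let Delta1 : Delta 1 = 1 *t 1.
Proof. exact: rmorph1. Qed.

Lemma primgen_coassociative : coassociative Delta.
Proof.
pose f : {lrmorphism H -> tensor H (tensor H H)} :=
  @tassoc F H H H \o (tmap Delta idfun \o Delta).
pose g : {lrmorphism H -> tensor H (tensor H H)} := tmap idfun Delta \o Delta.
apply: (@lrmorphism_ext _ f g) => i; rewrite /f /g /= Delta_x.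
rewrite !raddfD /= !tmapE /= Delta_x Delta1.
(* With [x] for [x_ i], both sides are the sum of the three tensors with [x] in one slot and [1] in
   the other two. *)
by rewrite linearDl linearDr !raddfD /= !tassocE addrA.
Qed.

Lemma primgen_cocommutative : cocommutative Delta.
Proof.
pose f : {lrmorphism H -> tensor H H} := @tswap F H H \o Delta.
apply: (@lrmorphism_ext _ f Delta) => i; rewrite /f /= Delta_x.
by rewrite raddfD /= !tswapE addrC.
Qed.

(** Both [tlift f \o Delta] and [g] turn left multiplication by [x_ i] into [phi i], and they agree
    at [1], hence on all words. The counit and antipode identities are four instances. *)
Lemma tlift_comul (f : H -> H -> H) (g : H -> H) (phi : X -> H -> H) :
    bilinear_for *:%R *:%R f -> linear g -> (forall i, linear (phi i)) ->
    f 1 1 = g 1 ->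
    (forall i a b, f (x_ i * a) b + f a (x_ i * b) = phi i (f a b)) ->
    (forall i u, g (x_ i * u) = phi i (g u)) ->
  forall h, tlift f (Delta h) = g h.
Proof.
move=> f_bil g_lin phi_lin f1 f_x g_x.
have tD s t : tlift f (s + t) = tlift f s + tlift f t.
  by have := tlift_linear f_bil 1 s t; rewrite !scale1r.
have phi0 i : phi i 0 = 0.
  by have := phi_lin i (-1) 0 0; rewrite scaler0 addr0 scaleN1r addNr.
apply: genP => [|a u v IHu IHv|i u IHu].
- by rewrite Delta1 tliftE.
- by rewrite linearP (tlift_linear f_bil) IHu IHv g_lin.
rewrite rmorphM /= Delta_x g_x -IHu {IHu}.
(* The claim is linear in [Delta u], so it is proved for every tensor in its place, reducing to pure
   tensors [a *t b]. *)
elim/tensor_ind: (Delta u) => [|c a b t IHt].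
  by rewrite mulr0 (tlift0 f_bil) phi0.
rewrite mulrDr -scalerAr !(tlift_linear f_bil) IHt phi_lin.
by rewrite mulrDl !tensM !mul1r tD !(tliftE f_bil) f_x.
Qed.

Lemma primgen_counital : counital Delta eps.
Proof.
move=> h; split.
- apply: (@tlift_comul (fun a b => eps a *: b) idfun
    (fun i u => x_ i * u)) => //=.
  + split=> [b c a a'|a c b b'] /=; first by rewrite linearP scalerDl scalerA.
    by rewrite scalerDr !scalerA mulrC.
  + by move=> i c u v; rewrite mulrDr scalerAr.
  + by rewrite rmorph1 scale1r.
  + by move=> i a b; rewrite rmorphM /= eps_x mul0r scale0r add0r scalerAr.
- apply: (@tlift_comul (fun a b => eps b *: a) idfun
    (fun i u => x_ i * u)) => //=.
  + split=> [b c a a'|a c b b'] /=; last by rewrite linearP scalerDl scalerA.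
    by rewrite scalerDr !scalerA mulrC.
  + by move=> i c u v; rewrite mulrDr scalerAr.
  + by rewrite rmorph1 scale1r.
  + by move=> i a b; rewrite rmorphM /= eps_x mul0r scale0r addr0 scalerAr.
Qed.

Lemma primgen_antipodal : antipodal Delta eps S.
Proof.
have eps_lin : linear (fun h => (eps h)%:A : H).
  by move=> c u v; rewrite linearP scalerDl scalerA.
move=> h; split.
- apply: (@tlift_comul (fun a b => S a * b) (fun h => (eps h)%:A)
    (fun _ _ => 0)) => //=.
  + split=> [b c a a'|a c b b'] /=; first by rewrite linearP mulrDl scalerAl.
    by rewrite mulrDr scalerAr.
  + by move=> i c u v; rewrite scaler0 addr0.
  + by rewrite rmorph1 scale1r S1 mulr1.
  (* [S (x_ i * a) * b] is [- S a * x_ i * b], which cancels the second term. *)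
  + by move=> i a b; rewrite SM S_x mulrN mulNr mulrA addNr.
  + by move=> i u; rewrite rmorphM /= eps_x mul0r scale0r.
- apply: (@tlift_comul (fun a b => a * S b) (fun h => (eps h)%:A)
    (fun i u => x_ i * u - u * x_ i)) => //=.
  + split=> [b c a a'|a c b b'] /=; first by rewrite mulrDl scalerAl.
    by rewrite linearP mulrDr scalerAr.
  + move=> i c u v; rewrite mulrDr mulrDl opprD addrACA.
    by rewrite -scalerAl -scalerAr -scalerBr.
  + by rewrite rmorph1 scale1r S1 mulr1.
  + by move=> i a b; rewrite SM S_x !mulrA mulrN.
  (* The right side is the commutator of [x_ i] with a scalar, hence zero. *)
  + move=> i u; rewrite rmorphM /= eps_x mul0r scale0r.
    by rewrite -scalerAl -scalerAr mul1r mulr1 subrr.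
Qed.

Lemma primgen_cocommutative_hopf : cocommutative_hopf_algebra Delta eps S.
Proof.
split; [split|].
- exact: primgen_coassociative.
- exact: primgen_counital.
- exact: primgen_antipodal.
- exact: primgen_cocommutative.
Qed.

End PrimitiveGenerators.
End AlgebraGenerators.

(** * Primitive tensors and their commutators *)

Section Primitive.
Variables (F : fieldType) (H : algType F).

Definition prim (u : H) : tensor H H := u *t 1 + 1 *t u.

Lemma prim_linear : linear prim.
Proof.
by move=> a u v; rewrite /prim linearPl linearPr scalerDr addrACA.
Qed.
HB.instance Definition _ :=
  GRing.isLinear.Build F H (tensor H H) *:%R prim prim_linear.

(** The cross terms [u *t v] and [v *t u] occur in both products and cancel. *)
Lemma prim_comm u v : prim u * prim v - prim v * prim u = prim (u * v - v * u).
Proof.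
have cancel_cross (V : zmodType) (a b c d x y : V) :
    (a + x + (y + b)) - (c + y + (x + d)) = (a - c) + (b - d).
  rewrite (addrACA a) opprD [LHS]addrACA.
  by rewrite (addrC c) addrKA (addrC x) addrKA.
rewrite /prim !mulrDl !mulrDr !tensM !mul1r !mulr1 linearBl linearBr.
exact: cancel_cross.
Qed.

End Primitive.

(** * The converse algebra over the field *)

Section ConverseAlgebra.
Variables (F : fieldType) (A : algType F).
Local Notation Ac := (GRing.converse A).

HB.instance Definition _ := GRing.Lmodule.copy Ac A.
Fact converse_scalerAl (a : F) (u v : Ac) : a *: (u * v) = (a *: u : Ac) * v.
Proof. exact: (scalerAr a (v : A) (u : A)). Qed.
Fact converse_scalerAr (a : F) (u v : Ac) : a *: (u * v) = u * (a *: v : Ac).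
Proof. exact: (scalerAl a (v : A) (u : A)). Qed.
HB.instance Definition _ :=
  GRing.Lmodule_isLalgebra.Build F Ac converse_scalerAl.
HB.instance Definition _ :=
  GRing.Lalgebra_isAlgebra.Build F Ac converse_scalerAr.

End ConverseAlgebra.

(** * Induction on words in the tensor algebra *)

Section TensorAlgInd.
Variables (F : fieldType) (V : lmodType F).

Lemma tensor_alg_ind (P : tensor_alg V -> Prop) : P 1 ->
  (forall a u v, P u -> P v -> P (a *: u + v)) ->
  (forall x u, P u -> P (tgen x * u)) -> forall u, P u.
Proof.
move=> P1 PD PM.
(* Zero is the combination [-1 *: 1 + 1]. *)
have P0 : P 0 by rewrite -(addNr 1) -scaleN1r; apply: PD.
move=> q; rewrite -[q]areprK; elim/free_alg_ind: (arepr q) => [|a k u IHu].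
  by rewrite raddf0.
rewrite (linearP (aproj (@tensor_alg_rel F V))); apply: PD => //.
case: k => k; elim: k => [|x k IHk].
  have -> : @word F V (FMonom [::]) = 1.
    exact: (congr1 (@word F V) (esym (fmoneE V))).
  by rewrite rmorph1.
have -> : word F (FMonom (x :: k)) = letter F x * word F (FMonom k).
  rewrite [RHS]fgmulUU mulr1 /word; congr << _ >>.
  by rewrite -[mmul _ _]/(fmmul _ _) fmmulE fmuE.
by rewrite rmorphM; apply: PM.
Qed.

End TensorAlgInd.

(** * Generators, universal property and structure maps of [UL_weak] *)

Section WeakEnveloping.
Variables (F : fieldType) (L : lmodType F) (mul : L -> L -> L).
Local Notation UL := (UL_weak mul).

(** Merges [ell] and [rr] into one linear map on the direct sum, so that a single family generates
    the algebra. *)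
Definition UL_gen (p : L * L) : UL := aproj (@UL_rel F L mul) (tgen p).

Lemma UL_gen_linear : linear UL_gen.
Proof. by move=> a p q; rewrite /UL_gen !linearP. Qed.
HB.instance Definition _ :=
  GRing.isLinear.Build F (L * L)%type UL *:%R UL_gen UL_gen_linear.

Lemma UL_genE p : UL_gen p = ell mul p.1 + rr mul p.2.
Proof.
rewrite /ell /rr -!/(UL_gen _) -raddfD.
by congr UL_gen; case: p => x y; congr (_, _); rewrite ?addr0 ?add0r.
Qed.

Lemma UL_alg_generators : alg_generators UL_gen.
Proof.
move=> P P1 PD PM q; rewrite -[q]areprK.
elim/tensor_alg_ind: (arepr q) => [|a u v IHu IHv|x u IHu].
- by rewrite rmorph1.
- by rewrite linearP; apply: PD.
- by rewrite rmorphM; apply: PM.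
Qed.

Lemma ell_comm x y :
  ell mul x * ell mul y - ell mul y * ell mul x = ell mul (mul x y).
Proof.
have rel : UL_rel mul (tgen (x, 0) * tgen (y, 0) - tgen (y, 0) * tgen (x, 0)
    - tgen (mul x y, 0)) by left; exists x, y.
by have /eqP := aproj_gen rel; rewrite !rmorphB !rmorphM subr_eq0 => /eqP.
Qed.

Lemma ell_rr_comm x y :
  ell mul x * rr mul y - rr mul y * ell mul x = rr mul (mul x y).
Proof.
have rel : UL_rel mul (tgen (x, 0) * tgen (0, y) - tgen (0, y) * tgen (x, 0)
    - tgen (0, mul x y)) by right; exists x, y.
by have /eqP := aproj_gen rel; rewrite !rmorphB !rmorphM subr_eq0 => /eqP.
Qed.

(** The hypotheses say that the extension of [f] to the tensor algebra kills the generators of the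
    defining ideal, so it factors through the quotient. *)
Lemma UL_lift (B : algType F) (f : {linear (L * L)%type -> B}) :
  (forall x y, f (x, 0) * f (y, 0) - f (y, 0) * f (x, 0) = f (mul x y, 0)) ->
  (forall x y, f (x, 0) * f (0, y) - f (0, y) * f (x, 0) = f (0, mul x y)) ->
  exists g : {lrmorphism UL -> B}, forall p, g (UL_gen p) = f p.
Proof.
move=> fl fr; have [g gE _] := tensor_alg_universal f.
have gG u : UL_rel mul u -> g u = 0.
  by case=> [] [x [y ->]]; rewrite !rmorphB !rmorphM /= !gE ?fl ?fr subrr.
pose h0 : UL -> B := aqlift g.
pose h : {lrmorphism UL -> B} := HB.pack h0
  (GRing.isZmodMorphism.Build UL B h0 (aqlift_is_zmod_morphism gG))
  (GRing.isMonoidMorphism.Build UL B h0 (aqlift_is_monoid_morphism gG))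
  (GRing.isScalable.Build F UL B *:%R h0 (aqlift_is_scalable gG)).
by exists h => p; apply: etrans (aqliftE gG _) (gE p).
Qed.

Lemma UL_comul_exists :
  exists Delta : {lrmorphism UL -> tensor UL UL},
    forall p, Delta (UL_gen p) = prim (UL_gen p).
Proof.
pose f : {linear (L * L)%type -> tensor UL UL} := @prim F UL \o UL_gen.
(* As [prim] preserves commutators, the relations for [f] are images of those in [UL]. *)
apply: (@UL_lift _ f) => x y; rewrite /f /= prim_comm; congr prim.
- exact: ell_comm.
- exact: ell_rr_comm.
Qed.

Lemma UL_counit_exists :
  exists eps : {lrmorphism UL -> F^o}, forall p, eps (UL_gen p) = 0.
Proof.
pose f : {linear (L * L)%type -> F^o} := \0.
by apply: (@UL_lift _ f) => x y; rewrite /f /= mulr0 subr0.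
Qed.

Lemma UL_antipode_exists :
  exists S : {linear UL -> UL},
    [/\ S 1 = 1, forall a b, S (a * b) = S b * S a
       & forall p, S (UL_gen p) = - UL_gen p].
Proof.
pose f : {linear (L * L)%type -> GRing.converse UL} := -%R \o UL_gen.
(* The signs cancel and the converse reverses the order, so commutators of values of [f] are negated
   commutators of generators, matching the sign in [f]. *)
have fM p q : f p * f q = UL_gen q * UL_gen p by exact: mulrNN.
have [x y|x y|S S_gen] := @UL_lift _ f.
- by rewrite !fM -opprB; congr (- _); apply: ell_comm.
- by rewrite !fM -opprB; congr (- _); apply: ell_rr_comm.
(* The converse has the same underlying space; multiplicativity into it is the anti-homomorphism
   law. *)
exists (S : {linear UL -> UL}); split=> //; first exact: (rmorph1 S).
exact: (rmorphM S).
Qed.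

End WeakEnveloping.

Theorem theorem3p12 (F : fieldType) (L : lmodType F)
    (mul : {bilinear L -> L -> L}) (mulP : left_leibniz mul) :
  exists (Delta : {lrmorphism UL_weak mul -> tensor (UL_weak mul) (UL_weak mul)})
         (eps : {lrmorphism UL_weak mul -> F^o})
         (S : {linear UL_weak mul -> UL_weak mul}),
    [/\ UL_comul Delta /\ (forall Delta', UL_comul Delta' -> Delta' =1 Delta),
        UL_counit eps /\ (forall eps', UL_counit eps' -> eps' =1 eps),
        UL_antipode S /\ (forall S', UL_antipode S' -> S' =1 S)
      & cocommutative_hopf_algebra Delta eps S].
Proof.
have [Delta Delta_gen] := UL_comul_exists mul.
have [eps eps_gen] := UL_counit_exists mul.
have [S [S1 SM S_gen]] := UL_antipode_exists mul.
have gens := @UL_alg_generators F L mul.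
exists Delta, eps, S; split.
- split=> [x|Delta' Delta'P]; first by split; apply: Delta_gen.
  (* Uniqueness: the values at [ell] and [rr] determine the value at each [UL_gen p] by
     additivity. *)
  apply: (lrmorphism_ext gens) => p; rewrite Delta_gen UL_genE.
  by rewrite !raddfD /= (Delta'P p.1).1 (Delta'P p.2).2.
- split=> [x|eps' eps'P]; first by split; apply: eps_gen.
  apply: (lrmorphism_ext gens) => p; rewrite eps_gen UL_genE.
  by rewrite raddfD /= (eps'P p.1).1 (eps'P p.2).2 addr0.
- split=> [|S' [S'1 S'M S'P]].
    by split=> // x; split; apply: S_gen.
  apply: (antimorphism_ext gens) => // p; rewrite S_gen UL_genE.
  by rewrite raddfD /= (S'P p.1).1 (S'P p.2).2 opprD.
- exact: (primgen_cocommutative_hopf gens).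
Qed.
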